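(* Let $\mu\ge1$ be a real number. Then $$\zeta(2\mu)\le\sqrt{\frac{3\pi}{2}}\;\frac{\Gamma(\mu+1)}{\Gamma(\mu+1/2)}$$ and $$\frac{\zeta(2\mu+1)^{3/2}}{\zeta(2\mu)^2\,\zeta(2\mu+3)}\le\frac{(\mu+1)\,\Gamma(\mu+1/2)^2}{\Gamma(\mu+1)^2}.$$
   Context: $\zeta(s)=\sum_{n=1}^\infty n^{-s}$ ($s>1$) is the Riemann zeta function and $\Gamma$ is the Gamma function. *)

(* Defs.v *)
From mathcomp Require Import all_boot all_order all_algebra.
From mathcomp Require Import all_classical all_reals all_analysis.

Set Implicit Arguments.
Unset Strict Implicit.
Unset Printing Implicit Defensive.

Import Order.TTheory GRing.Theory Num.Theory.
Import numFieldNormedType.Exports.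

Local Open Scope classical_set_scope.
Local Open Scope ring_scope.

(* riemannR s n is (n.+1)^-s, so the Dirichlet sum starts at 1^-s; the limit
   is meaningful only for s > 1. *)
Definition zeta (R : realType) (s : R) : R := limn (series (riemannR s)).

(* Euler's integral; meaningful only for x > 0, where it converges (otherwise
   Rintegral returns the junk value 0). *)
Definition Gamma (R : realType) (x : R) : R :=
  \int[lebesgue_measure]_(t in `]0, +oo[) (t `^ (x - 1) * expR (- t)).

(* Main.v *)
(* Integrating the AM-GM inequality
     2 sqrt(x) t^(x - 1/2) <= x t^(x - 1) + t^x
   against exp(-t), with Gamma(x + 1) = x Gamma(x), gives
     x Gamma(x + 1/2)^2 <= Gamma(x + 1)^2.
   At x = mu the Gamma quotient of the first inequality is at least 1, while
   zeta(2 mu) <= 5/3 <= sqrt(3 pi / 2). At x = mu + 1/2 the right-hand side of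
   the second inequality is at least 1, while its left-hand side is at most 1
   because 1 <= zeta(2 mu + 1) <= zeta(2 mu) and 1 <= zeta(2 mu + 3). *)

Require Import Defs.
From mathcomp Require Import all_boot all_order all_algebra.
From mathcomp Require Import all_classical all_reals all_analysis.
From mathcomp Require Import measurable_realfun ring lra.

Import Order.TTheory GRing.Theory Num.Theory.
Import numFieldNormedType.Exports.

Local Open Scope ring_scope.

(** * Integrability of the Gamma integrand *)

(** For [0 < t], apply [ln u < u] at [u = t / (2 * a + 1)] and multiply by [a]: the linear term has
    slope [a / (2 * a + 1) <= 1 / 2]. The summand 1 keeps the divisor positive at [a = 0]. *)
Lemma powR_le_expR_half (R : realType) (a t : R) : 0 <= a -> 0 <= t ->
  t `^ a <= (2 * a + 1) `^ a * expR (t / 2).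
Proof.
move=> a0; have c0 : 0 < 2 * a + 1 by lra.
rewrite le_eqVlt => /predU1P[<-|t0].
  rewrite mul0r expR0 mulr1; apply: ge0_ler_powR; rewrite ?nnegrE//; lra.
rewrite /powR !gt_eqF// -expRD ler_expR.
have tc0 : 0 < t / (2 * a + 1) by rewrite divr_gt0.
have /ltW := ln_sublinear tc0; rewrite ln_div ?posrE// lerBlDr => lnt.
apply: (le_trans (ler_wpM2l a0 lnt)); rewrite mulrDr addrC lerD2l.
rewrite mulrA ler_pdivrMr//; nra.
Qed.

Lemma continuous_expRN_half (R : realType) :
  continuous (fun t : R => expR (- (t / 2))).
Proof.
move=> x; apply: continuous_comp; last exact: continuous_expR.
by apply: cvgN; apply: cvgMl; exact: cvg_id.
Qed.

Lemma cvg_expRN_half (R : realType) :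
  (expR (- (t / 2)) @[t --> +oo] --> (0 : R))%classic.
Proof.
apply: (@cvg_comp _ _ _ (fun t : R => t / 2) (fun u => expR (- u)) _
  (pinfty_nbhs R)); last exact: cvgr_expR.
by apply: gt0_cvgMly; rewrite ?invr_gt0.
Qed.

Lemma integral_expRN_half (R : realType) :
  (\int[@lebesgue_measure R]_(t in `]0%R, +oo[) (expR (- (t / 2)))%:E = 2%:E)%E.
Proof.
have d (x : R) : is_derive x 1 (fun t => - 2 * expR (- (t / 2))) (expR (- (x / 2))).
  by apply: is_derive_eq; rewrite /GRing.scale/=; lra.
have c := @continuous_expRN_half R; have l0 := @cvg_expRN_half R.
rewrite integral_itv_obnd_cbnd; last first.
  apply/measurable_EFinP; apply: measurable_funTS.
  exact: continuous_measurable_fun.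
rewrite (@ge0_continuous_FTC2y _ _ (fun t => - 2 * expR (- (t / 2))) _ 0)//=.
- by rewrite mul0r oppr0 expR0 mulr1 -EFinB; congr EFin; lra.
- exact: continuous_subspaceT.
- by rewrite -[X in (_ --> X)%classic](mulr0 (- 2)); exact: cvgMr.
- by apply: cvg_at_right_filter; apply: cvgMr; exact: c.
- by move=> x _; rewrite derive1E; exact: derive_val.
Qed.

Lemma integrable_expRN_half (R : realType) :
  (@lebesgue_measure R).-integrable `]0, +oo[%classic
    (EFin \o (fun t => expR (- (t / 2)))).
Proof.
apply/integrableP; split.
  apply/measurable_EFinP; apply: measurable_funTS.
  apply: measurableT_comp => //; apply: measurableT_comp => //.
  exact: mulrr_measurable.
under eq_integral do rewrite /= ger0_norm ?expR_ge0//.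
by rewrite integral_expRN_half ltry.
Qed.

Lemma measurable_powR_expRN (R : realType) (a : R) (D : set R) :
  measurable_fun D (fun t => t `^ a * expR (- t)).
Proof.
apply: measurable_funTS; apply: measurable_funM; first exact: measurable_powR.
by apply: measurableT_comp.
Qed.

Lemma powR_expRN_le (R : realType) (a t : R) : 0 <= a -> 0 <= t ->
  t `^ a * expR (- t) <= (2 * a + 1) `^ a * expR (- (t / 2)).
Proof.
move=> a0 t0; rewrite [in leRHS](_ : - (t / 2) = t / 2 + - t); last by field.
by rewrite expRD mulrA ler_wpM2r ?expR_ge0// powR_le_expR_half.
Qed.

Lemma measurable_itv_0y (R : realType) :
  measurable (`]0, +oo[%classic : set (g_sigma_algebraType R.-ocitv.-measurable)).
Proof. exact: measurable_itv. Qed.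

Lemma integrable_powR_expRN (R : realType) (a : R) : 0 <= a ->
  (@lebesgue_measure R).-integrable `]0, +oo[%classic
    (EFin \o (fun t => t `^ a * expR (- t))).
Proof.
move=> a0.
have mI := measurable_itv_0y R.
have := integrableZl mI ((2 * a + 1) `^ a) (@integrable_expRN_half R).
apply: (le_integrable mI).
  by apply/measurable_EFinP; exact: measurable_powR_expRN.
move=> t; rewrite /= in_itv/= andbT => /ltW t0.
by rewrite lee_fin !ger0_norm ?mulr_ge0 ?powR_ge0 ?expR_ge0// powR_expRN_le.
Qed.

(** * Functional equation of Gamma *)

Lemma cvg_powR_expRN_at_right0 (R : realType) (a : R) : 0 <= a ->
  (t `^ a * expR (- t) @[t --> 0^'+] --> (0 `^ a * expR (- 0) : R))%classic.
Proof.
move=> a0; apply: cvgM; last first.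
  apply: cvg_at_right_filter; apply: continuous_comp; last exact: continuous_expR.
  by apply: cvgN; exact: cvg_id.
(* The limit of the power is 1 for [a = 0], matching the convention that zero to the power zero is
   1, and 0 for [a > 0]. *)
move: a0; rewrite le_eqVlt => /predU1P[<-|a0].
  by under eq_fun do rewrite powRr0; rewrite powRr0; exact: cvg_cst.
by rewrite powR0 ?gt_eqF//; exact: powR_cvg0.
Qed.

Lemma is_derive_powR_expRN (R : realType) (a t : R) : 0 < t ->
  is_derive t 1 (fun t => t `^ a * expR (- t))
    (a * (t `^ (a - 1) * expR (- t)) - t `^ a * expR (- t)).
Proof.
move=> t0; have dp := is_derive1_powR a t0.
by apply: is_derive_eq; rewrite /GRing.scale/=; ring.
Qed.

(** Integration by parts, done by integrating the derivative of [g] over the half-line. With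
    [1 <= x] the exponent [x - 1] is nonnegative, so both integrands stay bounded near 0. *)
Lemma GammaD1 (R : realType) (x : R) : 1 <= x -> Gamma (x + 1) = x * Gamma x.
Proof.
move=> x1; set K := (2 * x + 1) `^ x.
have x0 : 0 <= x by lra.
have x10 : 0 <= x - 1 by lra.
set e := fun t : R => expR (- (t / 2)).
set g := fun t : R => t `^ x * expR (- t).
set h := fun t : R => t `^ (x - 1) * expR (- t).
have mI := measurable_itv_0y R.
have ie := @integrable_expRN_half R; have ig := integrable_powR_expRN _ _ x0.
have ih := integrable_powR_expRN _ _ x10.
have ixh := integrableZl mI x ih; have iKe := integrableZl mI K ie.
have ixhg := integrableB mI ixh ig.
have Ie : (\int[@lebesgue_measure R]_(t in `]0%R, +oo[) e t = 2)%R.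
  by rewrite /Rintegral integral_expRN_half.
have dF (t : R) : 0 < t ->
    is_derive t 1 (fun t => g t - 2 * K * e t) (x * h t - g t + K * e t).
  move=> t0; have dg := is_derive_powR_expRN _ x _ t0.
  apply: is_derive_eq.
  rewrite /GRing.scale/= /g /h /e; lra.
(* The derivative x * h - g of g changes sign, whereas the improper FTC only
   applies to nonnegative integrands. Since K * e dominates g, adding K * e
   (the derivative of - 2 * K * e) repairs this. *)
suff : (\int[@lebesgue_measure R]_(t in `]0%R, +oo[)
    (x * h t - g t + K * e t) = 2 * K)%R.
  (* The [K * e] part integrates to [2 * K], which cancels and leaves
     [x * Gamma x - Gamma (x + 1) = 0]. *)
  rewrite RintegralD// RintegralB// !RintegralZl// Ie.
  rewrite /Gamma addrK -/g -/h => /eqP; rewrite [K * 2]mulrC -subr_eq0 addrK => h0.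
  by apply/eqP; rewrite eq_sym -subr_eq0.
rewrite Rintegral_itv_obnd_cbnd; last exact: (integrableD mI ixhg iKe).
rewrite (@Rintegral_ge0_continuous_FTC2y _ _ (fun t => g t - 2 * K * e t) _ 0)//=.
(* As [x] is positive, [g 0 = 0]: the antiderivative is [- 2 * K] at 0, and its limit at infinity is
   0. *)
- by rewrite /g /e powR0 ?gt_eqF// ?mul0r ?oppr0 ?expR0; [ring|lra].
- move=> t t0; rewrite -addrA addr_ge0//.
    by rewrite !mulr_ge0 ?powR_ge0 ?expR_ge0.
  by rewrite addrC subr_ge0 powR_expRN_le.
- apply/continuous_within_itvcyP; split.
    move=> t; rewrite in_itv/= andbT => t0.
    apply: differentiable_continuous; apply/derivable1_diffP.
    have dg := is_derive_powR_expRN _ x _ t0.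
    have dh := is_derive_powR_expRN _ (x - 1) _ t0.
    by apply: ex_derive.
  apply: cvgD; last first.
    by apply: cvgMr; apply: cvg_at_right_filter; exact: continuous_expRN_half.
  apply: cvgB; last exact: cvg_powR_expRN_at_right0.
  by apply: cvgMr; exact: cvg_powR_expRN_at_right0.
- rewrite -[X in (_ --> X)%classic]subr0; apply: cvgB; last first.
    by rewrite -(mulr0 (2 * K)); apply: cvgMr; exact: cvg_expRN_half.
  apply: (@squeeze_cvgr _ _ _ _ (fun=> 0) (fun t => K * e t)).
  + near=> t; have t0 : 0 <= t by near: t; exact: nbhs_pinfty_ge.
    by rewrite mulr_ge0 ?powR_ge0 ?expR_ge0//= powR_expRN_le.
  + exact: cvg_cst.
  + by rewrite -(mulr0 K); apply: cvgMr; exact: cvg_expRN_half.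
- by move=> t t0; case: (dF t t0).
- apply: cvgB; first exact: cvg_powR_expRN_at_right0.
  by apply: cvgMr; apply: cvg_at_right_filter; exact: continuous_expRN_half.
- by move=> t; rewrite in_itv/= andbT => t0; rewrite derive1E; case: (dF t t0).
Unshelve. all: by end_near.
Qed.

Lemma Gamma_ge0 (R : realType) (x : R) : 0 <= Gamma x.
Proof.
by apply: Rintegral_ge0 => t _; rewrite mulr_ge0 ?powR_ge0 ?expR_ge0.
Qed.

(** * AM-GM under the Gamma integral *)

(** The difference of the two sides is t^(x-1) (sqrt x - sqrt t)^2. *)
Lemma powR_half_amgm (R : realType) (x t : R) : 0 <= x -> 0 < t ->
  2 * Num.sqrt x * t `^ (x + 1 / 2 - 1) <= x * t `^ (x - 1) + t `^ (x + 1 - 1).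
Proof.
move=> x0 t0.
have pD (r : R) : t `^ (x - 1 + r) = t `^ (x - 1) * t `^ r.
  by rewrite powRD// (gt_eqF t0) implybT.
rewrite (_ : x + 1 / 2 - 1 = x - 1 + 2^-1); last by lra.
rewrite (addrAC x 1) !pD powRr1 ?(ltW t0)// powR12_sqrt ?(ltW t0)//.
rewrite -[X in X * _ + _](sqr_sqrtr x0) -[X in _ + _ * X](sqr_sqrtr (ltW t0)).
rewrite -subr_ge0.
rewrite [leRHS](_ : _ = t `^ (x - 1) * (Num.sqrt x - Num.sqrt t) ^+ 2).
  by rewrite mulr_ge0 ?powR_ge0 ?sqr_ge0.
by ring.
Qed.

Lemma Gamma_add_half_sqr_le (R : realType) (x : R) : 1 <= x ->
  x * Gamma (x + 1 / 2) ^+ 2 <= Gamma (x + 1) ^+ 2.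
Proof.
move=> x1; have x0 : 0 <= x by lra.
set c := Num.sqrt x.
have c0 : 0 < c by rewrite sqrtr_gt0; lra.
have cc : c * c = x by rewrite -expr2 sqr_sqrtr; lra.
have mI := measurable_itv_0y R.
have iG (y : R) : 1 <= y -> (@lebesgue_measure R).-integrable `]0, +oo[%classic
    (EFin \o (fun t => t `^ (y - 1) * expR (- t))).
  by move=> y1; apply: integrable_powR_expRN; rewrite subr_ge0.
have amgm : 2 * c * Gamma (x + 1 / 2) <= x * Gamma x + Gamma (x + 1).
  have [x'1 x''1] : 1 <= x + 1 / 2 /\ 1 <= x + 1 by lra.
  have ih := iG _ x1; have ig := iG _ x''1; have im := iG _ x'1.
  have ixh := integrableZl mI x ih; have icm := integrableZl mI (2 * c) im.
  rewrite /Gamma -(RintegralZl _ mI im) -(RintegralZl _ mI ih) -RintegralD//.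
  apply: le_Rintegral => //; first exact: (integrableD mI ixh ig).
  move=> t; rewrite /= in_itv/= andbT => t0.
  rewrite !mulrA -mulrDl ler_wpM2r ?expR_ge0//.
  exact: powR_half_amgm.
have {}amgm : c * Gamma (x + 1 / 2) <= Gamma (x + 1).
  (* The functional equation makes the right-hand side [2 * Gamma (x + 1)], so the factor 2
     cancels. *)
  by move: amgm; rewrite -(GammaD1 _ x)// -mulr2n -[leRHS]mulr_natl -mulrA ler_pM2l.
by rewrite -[X in X * _]cc -expr2 -exprMn lerXn2r// nnegrE ?mulr_ge0 ?Gamma_ge0// ltW.
Qed.

(** * Bounds for zeta *)

(* Telescoping 1/k^2 <= 1/(k - 1/2) - 1/(k + 1/2) from k = 2 on; the cruder
   bound zeta 2 <= 2 would need pi >= 8/3, and only pi >= 2 is at hand. *)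
Lemma series_riemannR_ub (R : realType) (s : R) (n : nat) : 2 <= s ->
  series (riemannR s) n.+1 <= 5 / 3 - (n%:R + 3 / 2)^-1.
Proof.
move=> s2; elim: n => [|n IHn].
  (* Equality holds here: the first term is 1 = 5/3 - 2/3, which is where 5/3 comes from. *)
  by rewrite /series/= big_nat1 /riemannR powR1 invr1 add0r; lra.
rewrite /series/= big_nat_recr//=.
have n0 : 0 <= n%:R :> R by [].
have : (n.+2%:R `^ s)^-1 <= (n%:R + 3 / 2)^-1 - (n.+1%:R + 3 / 2)^-1 :> R.
  have -> : (n%:R + 3 / 2)^-1 - (n.+1%:R + 3 / 2)^-1
            = ((n%:R + 3 / 2) * (n%:R + 5 / 2))^-1 :> R.
    rewrite -[n.+1%:R]natr1; move: (n%:R) n0 => m m0.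
    by field; apply/andP; split; rewrite gt_eqF//; lra.
  rewrite lef_pV2 ?posrE ?powR_gt0//.
  (* With k = n + 2, the product (n + 3/2)(n + 5/2) is k^2 - 1/4. *)
  apply: (@le_trans _ _ (n.+2%:R ^+ 2)).
    by rewrite -[n.+2%:R]natr1 -[n.+1%:R]natr1; nra.
  by rewrite -powR_mulrn// ler_powR// ler1n.
by move=> h; apply: (le_trans (lerD IHn h)); rewrite addrA subrK.
Qed.

Lemma cvg_series_riemannR (R : realType) (s : R) : 2 <= s ->
  cvgn (series (riemannR s)).
Proof.
move=> s2; have r0 n : 0 <= riemannR s n by rewrite ltW// riemannR_gt0//; lra.
apply: nondecreasing_is_cvgn.
  by apply/nondecreasing_seqP => n; rewrite /series/= big_nat_recr//= lerDl.
exists (5 / 3) => _ [n _ <-].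
(* The upper bound is stated for [n.+1] terms, so one nonnegative term is added first. *)
apply: (@le_trans _ _ (series (riemannR s) n.+1)).
  by rewrite [leRHS]/series/= big_nat_recr//= lerDl.
by apply: (le_trans (series_riemannR_ub _ _ n s2)); rewrite gerBl invr_ge0 addr_ge0.
Qed.

Lemma zeta_ge1 (R : realType) (s : R) : 2 <= s -> 1 <= zeta s.
Proof.
move=> s2; have r0 n : 0 <= riemannR s n by rewrite ltW// riemannR_gt0//; lra.
apply: limr_ge; first exact: cvg_series_riemannR.
exists 1%N => // n /= n1; rewrite /series/= big_ltn// {1}/riemannR powR1 invr1 lerDl.
by apply: sumr_ge0.
Qed.

Lemma zeta_le (R : realType) (s s' : R) : 2 <= s -> s <= s' -> zeta s' <= zeta s.
Proof.
move=> s2 ss'.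
apply: ler_lim; [apply: cvg_series_riemannR; lra|exact: cvg_series_riemannR|].
apply: nearW => n; apply: ler_sum => i _.
by rewrite /riemannR lef_pV2 ?posrE ?powR_gt0// ler_powR// ler1n.
Qed.

Lemma zeta_le53 (R : realType) (s : R) : 2 <= s -> zeta s <= 5 / 3.
Proof.
move=> s2; apply: limr_le; first exact: cvg_series_riemannR.
exists 1%N => // -[//|n] _ /=; apply: (le_trans (series_riemannR_ub _ _ n s2)).
by rewrite gerBl invr_ge0 addr_ge0.
Qed.

(** * Positivity of Gamma and the two inequalities *)

(** On [1, 2] the integrand is at least exp(-2), since t^(x-1) >= 1 there. This justifies clearing
    the Gamma denominators. *)
Lemma Gamma_gt0 (R : realType) (x : R) : 1 <= x -> 0 < Gamma x.
Proof.
move=> x1; have x10 : 0 <= x - 1 by rewrite subr_ge0.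
have iG := integrable_powR_expRN _ _ x10.
rewrite -lte_fin /Gamma fineK; last exact: integrable_fin_num iG.
have f0 (t : R) : (0 <= (t `^ (x - 1) * expR (- t))%:E)%E.
  by rewrite lee_fin mulr_ge0 ?powR_ge0 ?expR_ge0.
apply: (@lt_le_trans _ _ (\int[@lebesgue_measure R]_(t in `[1%R, 2%R]) (expR (- 2))%:E)%E).
  rewrite integral_cst//= lebesgue_measure_itv/= lte_fin ltr1n/= -EFinB -EFinM lte_fin.
  by rewrite mulr_gt0 ?expR_gt0// subr_gt0 ltr1n.
apply: (@le_trans _ _ (\int[@lebesgue_measure R]_(t in `[1%R, 2%R])
    (t `^ (x - 1) * expR (- t))%:E)%E).
  apply: ge0_le_integral => //.
  - by apply/measurable_EFinP; exact: measurable_powR_expRN.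
  - move=> t; rewrite /= in_itv/= => /andP[t1 t2].
    rewrite lee_fin -[leLHS]mul1r; apply: ler_pM => //.
      by rewrite -[leLHS](powRr0 t) ler_powR.
    by rewrite ler_expR lerN2.
apply: ge0_subset_integral => //.
  by apply/measurable_EFinP; exact: measurable_powR_expRN.
by move=> t; rewrite /= !in_itv/= andbT => /andP[t1 _]; exact: lt_le_trans t1.
Qed.

Theorem theorem7 (R : realType) (mu : R) (hmu : 1 <= mu) :
  zeta (2 * mu)
    <= Num.sqrt (3 * pi / 2) * (Gamma (mu + 1) / Gamma (mu + 1 / 2)) /\
  zeta (2 * mu + 1) `^ (3 / 2) / (zeta (2 * mu) ^+ 2 * zeta (2 * mu + 3))
    <= (mu + 1) * Gamma (mu + 1 / 2) ^+ 2 / Gamma (mu + 1) ^+ 2.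
Proof.
have [h1 h2] : 1 <= mu + 1 / 2 /\ 1 <= mu + 1 by lra.
have g1 := Gamma_gt0 _ _ h1; have g2 := Gamma_gt0 _ _ h2.
have s2 : 2 <= 2 * mu by lra.
split.
  apply: (le_trans (zeta_le53 _ _ s2)); rewrite -[leLHS]mulr1.
  apply: ler_pM => //.
    (* From pi >= 2 follows 3 pi / 2 >= 3, which exceeds (5/3)^2 = 25/9. *)
    have pi2 := @pi_ge2 R.
    by rewrite -[leLHS]ger0_norm// -sqrtr_sqr ler_psqrt ?nnegrE; lra.
  rewrite ler_pdivlMr// [leLHS]mul1r -ler_sqr ?nnegrE ?(ltW g1) ?(ltW g2)//.
  apply: le_trans (Gamma_add_half_sqr_le _ _ hmu).
  by rewrite ler_peMl ?sqr_ge0.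
have z0 := zeta_ge1 _ _ s2.
have z1 : 1 <= zeta (2 * mu + 1) by apply: zeta_ge1; lra.
have z3 : 1 <= zeta (2 * mu + 3) by apply: zeta_ge1; lra.
have z10 : zeta (2 * mu + 1) <= zeta (2 * mu) by apply: zeta_le; lra.
apply: (@le_trans _ _ 1).
  rewrite ler_pdivrMr ?mul1r; last first.
    by rewrite mulr_gt0 ?exprn_gt0//; exact: lt_le_trans ltr01 _.
  apply: (@le_trans _ _ (zeta (2 * mu) ^+ 2)); last first.
    by rewrite -[leLHS]mulr1 ler_wpM2l ?sqr_ge0.
  apply: (@le_trans _ _ (zeta (2 * mu + 1) ^+ 2)); last first.
    by rewrite lerXn2r// nnegrE (le_trans ler01).
  (* The base is at least 1, so the exponent 3/2 may be raised to 2. *)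
  by rewrite -powR_mulrn ?(le_trans ler01)// ler_powR//; lra.
rewrite ler_pdivlMr ?exprn_gt0// [leLHS]mul1r.
(* Since [Gamma (mu + 3/2)] is [(mu + 1/2) * Gamma (mu + 1/2)], one factor [mu + 1/2] cancels; the
   other is at most [mu + 1]. *)
have := Gamma_add_half_sqr_le _ _ h1.
rewrite GammaD1// -addrA (_ : 1 / 2 + 1 / 2 = 1); last by lra.
rewrite exprMn [(mu + 1 / 2) ^+ 2]expr2 -mulrA ler_pM2l; last by lra.
move=> /le_trans; apply; apply: ler_wpM2r; first exact: sqr_ge0.
lra.
Qed.
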